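(* Let $\ast$ be a binary operation on $I=[0,1]$ and let $\nabla$ be a t-conorm on $I$. If the binary operation $\widetilde{\nabla}_{\ast}$ is a t$_{r}$-conorm on $\mathbf{L}$, then $\nabla$ is a continuous t-conorm on $I$ and $\ast$ is a t-norm on $I$.
   Context: Let $I=[0,1]$ and let $\mathbf{M}$ be the set of all maps $I\to I$; $\wedge,\vee$ denote minimum and maximum of real numbers. A function $f\in\mathbf{M}$ is normal if $\sup\{f(x)\mid x\in I\}=1$, and convex if $f(y)\ge f(x)\wedge f(z)$ whenever $0\le x\le y\le z\le 1$. $\mathbf{L}$ is the set of all normal and convex $f\in\mathbf{M}$. For $B\subseteq I$, $\bm{1}_B\in\mathbf{M}$ is the characteristic function of $B$. Let $\mathbf{J}=\{\bm{1}_{\{x\}}\mid x\in I\}$ and $\mathbf{K}=\{\bm{1}_{[a,b]}\mid 0\le a\le b\le 1\}$. For $f,g\in\mathbf{M}$ define $(f\sqcap g)(x)=\sup\{f(y)\wedge g(z)\mid y\wedge z=x\}$, and write $f\sqsubseteq g$ if $f\sqcap g=f$. A t-norm (resp. t-conorm) on $I$ is a binary operation $I^2\to I$ that is commutative, associative, increasing (non-decreasing) in each argument, and has neutral element $1$ (resp. $0$). Given a binary operation $\ast:I^2\to I$ (arbitrary) and a t-conorm $\nabla$ on $I$, the binary operation $\widetilde{\nabla}_{\ast}:\mathbf{M}^2\to\mathbf{M}$ is defined by $$(f\,\widetilde{\nabla}_{\ast}\,g)(x)=\sup\{f(y)\ast g(z)\mid y,z\in I,\ y\nabla z=x\},\qquad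 f,g\in\mathbf{M},\ x\in I.$$ A t$_{r}$-conorm on $\mathbf{L}$ is a binary operation $S:\mathbf{L}^2\to\mathbf{L}$ such that: (O1) $S(f,g)=S(g,f)$ for all $f,g\in\mathbf{L}$; (O2) $S(S(f,g),h)=S(f,S(g,h))$ for all $f,g,h\in\mathbf{L}$; (O3') $S(f,\bm{1}_{\{0\}})=f$ for all $f\in\mathbf{L}$; (O4) for $f,g,h\in\mathbf{L}$ with $f\sqsubseteq g$, $S(f,h)\sqsubseteq S(g,h)$; (O5') $S(\bm{1}_{[0,1]},\bm{1}_{[a,b]})=\bm{1}_{[a,1]}$ for all $0\le a\le b\le 1$; (O6) $S$ is closed on $\mathbf{J}$; (O7) $S$ is closed on $\mathbf{K}$. Saying that $\widetilde{\nabla}_{\ast}$ is a t$_{r}$-conorm on $\mathbf{L}$ means that its restriction to $\mathbf{L}^2$ takes values in $\mathbf{L}$ and is a t$_r$-conorm. *)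

(* Defs.v *)
From mathcomp Require Import all_boot all_order all_algebra.
From mathcomp Require Import all_classical all_reals all_analysis.
Set Implicit Arguments.
Unset Strict Implicit.
Unset Printing Implicit Defensive.
Import Order.TTheory GRing.Theory Num.Theory.
Import numFieldNormedType.Exports.
Local Open Scope classical_set_scope.
Local Open Scope ring_scope.

Definition I (R : realType) := {i01 R}.

Definition Mmap (R : realType) := I R -> I R.

Definition vals (R : realType) (A : set (I R)) : set R :=
  [set x%:num | x in A].

Lemma sup_vals_ge0 (R : realType) (A : set (I R)) : 0 <= sup (vals A).
Proof.
have [->|/set0P[x Ax]] := eqVneq A set0; first by rewrite /vals image_set0 sup0.
apply: (@le_trans _ _ x%:num) => //; apply: ub_le_sup; last by exists x.
by exists 1 => _ [y _ <-].
Qed.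

Lemma sup_vals_le1 (R : realType) (A : set (I R)) : sup (vals A) <= 1.
Proof.
have [->|/set0P[x Ax]] := eqVneq A set0; first by rewrite /vals image_set0 sup0.
by apply: ge_sup; [exists x%:num, x|move=> _ [y _ <-]].
Qed.

(* Supremum in the complete lattice [0, 1]; the empty set has supremum 0. *)
Definition supI (R : realType) (A : set (I R)) : I R :=
  Itv01 (sup_vals_ge0 A) (sup_vals_le1 A).

Definition normal_map (R : realType) (f : Mmap R) : Prop :=
  supI (range f) = 1%:i01.

Definition convex_map (R : realType) (f : Mmap R) : Prop :=
  forall x y z : I R, x <= y -> y <= z -> Order.min (f x) (f z) <= f y.

Definition Lset (R : realType) : set (Mmap R) :=
  [set f | normal_map f /\ convex_map f].

Definition char_map (R : realType) (B : set (I R)) : Mmap R :=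
  fun x => if x \in B then 1%:i01 else 0%:i01.

Definition Jset (R : realType) : set (Mmap R) :=
  [set char_map [set x] | x in [set: I R]].

Definition Kset (R : realType) : set (Mmap R) :=
  [set f | exists a b : I R, a <= b /\ f = char_map `[a, b]].

Definition meet_map (R : realType) (f g : Mmap R) : Mmap R :=
  fun x => supI [set w | exists y z : I R,
    Order.min y z = x /\ w = Order.min (f y) (g z)].

Definition sqsub (R : realType) (f g : Mmap R) : Prop := meet_map f g = f.

Definition nondecreasing2 (R : realType) (op : I R -> I R -> I R) : Prop :=
  (forall z x y, x <= y -> op x z <= op y z) /\
  (forall z x y, x <= y -> op z x <= op z y).

Definition is_tnorm (R : realType) (op : I R -> I R -> I R) : Prop :=
  [/\ commutative op, associative op, nondecreasing2 op
    & forall x, op x 1%:i01 = x].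

Definition is_tconorm (R : realType) (op : I R -> I R -> I R) : Prop :=
  [/\ commutative op, associative op, nondecreasing2 op
    & forall x, op x 0%:i01 = x].

(* [0, 1] carries the topology induced by the inclusion into R. *)
Definition Itop (R : realType) : topologicalType :=
  initial_topology (fun x : I R => x%:num).

Definition continuous2 (R : realType) (op : I R -> I R -> I R) : Prop :=
  continuous (fun xy : Itop R * Itop R => op xy.1 xy.2 : Itop R).

Definition conv_map (R : realType) (star nabla : I R -> I R -> I R)
    (f g : Mmap R) : Mmap R :=
  fun x => supI [set w | exists y z : I R,
    nabla y z = x /\ w = star (f y) (g z)].

(* The restriction of S to L is an operation on L that is a t_r-conorm. *)
Record is_tr_conorm (R : realType) (S : Mmap R -> Mmap R -> Mmap R) : Prop := {
  trc_closedL : forall f g, Lset f -> Lset g -> Lset (S f g);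
  trc_comm : forall f g, Lset f -> Lset g -> S f g = S g f;
  trc_assoc : forall f g h, Lset f -> Lset g -> Lset h ->
    S (S f g) h = S f (S g h);
  trc_neutral : forall f, Lset f -> S f (char_map [set 0%:i01]) = f;
  trc_mono : forall f g h, Lset f -> Lset g -> Lset h ->
    sqsub f g -> sqsub (S f h) (S g h);
  trc_interval : forall a b : I R, a <= b ->
    S (char_map `[0%:i01, 1%:i01]) (char_map `[a, b]) =
    char_map `[a, 1%:i01];
  trc_closedJ : forall f g, Jset f -> Jset g -> Jset (S f g);
  trc_closedK : forall f g, Kset f -> Kset g -> Kset (S f g)
}.

(* Main.v *)
Require Import Defs.
From mathcomp Require Import all_boot all_order all_algebra.
From mathcomp Require Import all_classical all_reals all_analysis.
From mathcomp Require Import lra.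

(** The operation [star] is recovered from the values at [0] of members of L.
    Since [nabla y z] dominates both [y] and [z], the only way to write [0] as
    [nabla y z] is [y = z = 0]; hence the convolution of [f] and [g] takes the
    value [star (f 0) (g 0)] at [0] (lemma [conv_map0]).  The maps equal to an
    arbitrary [c] at [0] and to [1] elsewhere ([spike0]) belong to L and realize
    every value [c] at [0], so evaluating at [0] turns commutativity,
    associativity and neutrality of the convolution into the same laws for
    [star].  Monotonicity comes out likewise: the order on L reverses the order
    of the values at [0], both for the maps [spike0 c] ([sqsub_spike0]) and,
    conversely, for any two maps the smaller of which is [1] at the point [1]
    ([sqsub_ge0]).

    Continuity of [nabla] comes from the interval axiom on degenerate intervals
    [[a, a]]: convolving the indicators of [[0, 1]] and of [{a}] must give the
    indicator of [[a, 1]].  As [star] is now a t-norm, this says that the section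
    [y |-> nabla y a] maps [[0, 1]] onto [[a, 1]] ([nabla_section_onto]).  A
    monotone map onto an interval has no jumps; applying this in one variable and
    then in the other traps a value of [nabla] between the values at the corners
    of a small rectangle ([corner_above], [corner_below]), which is joint
    continuity ([continuous2_of_onto]). *)

Set Implicit Arguments.
Unset Strict Implicit.
Unset Printing Implicit Defensive.
Import Order.TTheory GRing.Theory Num.Theory.
Import numFieldNormedType.Exports.
Local Open Scope classical_set_scope.
Local Open Scope ring_scope.

(** * Suprema and order in the unit interval *)

Lemma le_supI (R : realType) (A : set (I R)) (w : I R) : A w -> w <= supI A.
Proof.
move=> Aw; suff : w%:num <= sup (vals A) by [].
by apply: ub_le_sup; [exists 1 => _ [y _ <-] | exists w].
Qed.

(** The empty set causes no exception, its supremum being the least element. *)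
Lemma supI_le (R : realType) (A : set (I R)) (u : I R) :
  (forall w, A w -> w <= u) -> supI A <= u.
Proof.
move=> Au; suff : sup (vals A) <= u%:num by [].
have [->|/set0P[x Ax]] := eqVneq A set0; first by rewrite /vals image_set0 sup0.
by apply: ge_sup => [|_ [w /Au wu <-]]; [exists x%:num, x | exact: wu].
Qed.

Lemma supI_max (R : realType) (A : set (I R)) (u : I R) :
  A u -> (forall w, A w -> w <= u) -> supI A = u.
Proof. by move=> Au ub; apply/le_anti; rewrite supI_le ?le_supI. Qed.

Lemma I_ge0 (R : realType) (x : I R) : 0%:i01 <= x.
Proof. by suff : 0 <= x%:num by []. Qed.

Lemma I_le1 (R : realType) (x : I R) : x <= 1%:i01.
Proof. by suff : x%:num <= 1 by []. Qed.

Lemma I_le0 (R : realType) (x : I R) : x <= 0%:i01 -> x = 0%:i01.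
Proof. by move=> x0; apply/le_anti; rewrite x0 I_ge0. Qed.

Lemma I_neq01 (R : realType) : (0%:i01 : I R) <> 1%:i01.
Proof. by move=> /(congr1 (fun x : I R => x%:num)) /= /eqP; rewrite eq_sym oner_eq0. Qed.

Lemma I_between (R : realType) (u v : R) (x y : I R) :
  x%:num <= u -> u < v -> v <= y%:num -> exists2 z : I R, u < z%:num & z%:num < v.
Proof.
move=> xu uv vy; have x0 : 0 <= x%:num by []; have y1 : y%:num <= 1 by [].
have m0 : 0 <= (u + v) / 2 by lra.
have m1 : (u + v) / 2 <= 1 by lra.
by exists (Itv01 m0 m1) => /=; lra.
Qed.

Lemma I_dense (R : realType) (x y : I R) :
  x < y -> exists2 z : I R, x < z & z < y.
Proof.
move=> xy; have := @I_between R x%:num y%:num x y (lexx _) xy (lexx _).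
by case=> z; exists z.
Qed.

(** * The convolution at the least point *)

Lemma tconorm_ge (R : realType) (nabla : I R -> I R -> I R) (y z : I R) :
  is_tconorm nabla -> y <= nabla y z /\ z <= nabla y z.
Proof.
move=> [nC _ [nl nr] n0]; split.
  by rewrite -{1}(n0 y); apply: nr; exact: I_ge0.
by rewrite -{1}(n0 z) nC; apply: nl; exact: I_ge0.
Qed.

Lemma conv_map0 (R : realType) (star nabla : I R -> I R -> I R) (f g : Mmap R) :
  is_tconorm nabla ->
  conv_map star nabla f g 0%:i01 = star (f 0%:i01) (g 0%:i01).
Proof.
move=> hn; apply: supI_max.
  by exists 0%:i01, 0%:i01; split=> //; have [_ _ _] := hn; exact.
move=> w [y [z [yz ->]]]; have [] := tconorm_ge y z hn.
by rewrite yz => /I_le0 -> /I_le0 ->.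
Qed.

Definition spike0 (R : realType) (c : I R) : Mmap R :=
  fun x => if x == 0%:i01 then c else 1%:i01.

Lemma spike0_0 (R : realType) (c : I R) : spike0 c 0%:i01 = c.
Proof. by rewrite /spike0 eqxx. Qed.

Lemma spike0_1 (R : realType) (c : I R) : spike0 c 1%:i01 = 1%:i01.
Proof. by rewrite /spike0; case: eqP => // /esym /I_neq01. Qed.

Lemma Lset_spike0 (R : realType) (c : I R) : Lset (spike0 c).
Proof.
split; first apply: supI_max => [|w _]; last 1 first.
- move=> x y z xy _; rewrite /spike0; case: (y =P _) => [y0|_]; last exact: I_le1.
  have -> : x = 0%:i01 by apply: I_le0; rewrite -y0.
  by rewrite eqxx ge_min lexx.
- by exists 1%:i01 => //; exact: spike0_1.
- exact: I_le1.
Qed.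

Lemma sqsub_spike0 (R : realType) (a b : I R) :
  a <= b -> sqsub (spike0 b) (spike0 a).
Proof.
move=> ab; apply/funext => x; apply: supI_max; last first.
  move=> _ [y [z [<- ->]]]; rewrite {3}/spike0; case: (_ =P _) => [yz|_].
    have [y0|z0] : y = 0%:i01 \/ z = 0%:i01.
      by move: yz; case: (leP y z) => _ ->; [left|right].
    - by rewrite y0 spike0_0 ge_min lexx.
    - by rewrite z0 spike0_0 ge_min ab orbT.
  exact: I_le1.
exists x, 1%:i01; split; first exact/min_idPl/I_le1.
by rewrite spike0_1; apply/esym/min_idPl/I_le1.
Qed.

(** The meet at [0] already takes the supremum over all pairs [(y, 0)], so it
    is at least [g 0] once [f] reaches [1]. *)
Lemma sqsub_ge0 (R : realType) (f g : Mmap R) :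
  f 1%:i01 = 1%:i01 -> sqsub f g -> g 0%:i01 <= f 0%:i01.
Proof.
move=> f1 <-; apply: le_supI; exists 1%:i01, 0%:i01; split.
  exact/min_idPr/I_ge0.
by rewrite f1; apply/esym/min_idPr/I_le1.
Qed.

Lemma star_right_unit (R : realType) (star nabla : I R -> I R -> I R) :
  is_tconorm nabla -> is_tr_conorm (conv_map star nabla) ->
  forall x, star x 1%:i01 = x.
Proof.
move=> hn htr x.
have /(congr1 (fun f : Mmap R => f 0%:i01)) := trc_neutral htr (Lset_spike0 x).
by rewrite conv_map0 // spike0_0 /char_map mem_set.
Qed.

Lemma conv_map_spike0_1 (R : realType) (star nabla : I R -> I R -> I R)
    (b c : I R) : is_tconorm nabla -> (forall x, star x 1%:i01 = x) ->
  conv_map star nabla (spike0 b) (spike0 c) 1%:i01 = 1%:i01.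
Proof.
move=> hn s1; apply/le_anti; rewrite I_le1 /=; apply: le_supI.
exists 1%:i01, 1%:i01; rewrite !spike0_1 s1; split=> //.
apply/le_anti; rewrite I_le1 /=.
by have [] := tconorm_ge (1%:i01 : I R) 1%:i01 hn.
Qed.

Lemma star_tnorm (R : realType) (star nabla : I R -> I R -> I R) :
  is_tconorm nabla -> is_tr_conorm (conv_map star nabla) -> is_tnorm star.
Proof.
move=> hn htr; have s1 := star_right_unit hn htr.
pose L := @Lset_spike0 R.
have sC : commutative star.
  move=> x y; have := trc_comm htr (L x) (L y).
  move=> /(congr1 (fun f : Mmap R => f 0%:i01)).
  by rewrite !conv_map0 // !spike0_0.
have smono z x y : x <= y -> star x z <= star y z.
  move=> xy; have := trc_mono htr (L y) (L x) (L z) (sqsub_spike0 xy).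
  move=> /(sqsub_ge0 (conv_map_spike0_1 y z hn s1)).
  by rewrite !conv_map0 // !spike0_0.
split=> //; last by split=> // z x y xy; rewrite ![star z _]sC smono.
move=> x y z; have := trc_assoc htr (L x) (L y) (L z).
move=> /(congr1 (fun f : Mmap R => f 0%:i01)).
by rewrite !conv_map0 // !spike0_0.
Qed.

(** * Continuity of the t-conorm *)

(** On indicators the convolution is the indicator of a sum set, up to the
    possibility that the supremum is not attained; this cannot occur here, as
    [star] only takes the values [0] and [1] on pairs of such values. *)
Lemma nabla_section_onto (R : realType) (star nabla : I R -> I R -> I R) :
  is_tnorm star -> is_tr_conorm (conv_map star nabla) ->
  forall a t : I R, a <= t -> exists y, nabla y a = t.
Proof.
move=> [sC _ [sl _] s1] htr a t at_; apply: contrapT => no_y.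
have /(congr1 (fun f : Mmap R => f t)) := trc_interval htr (lexx a).
have -> : char_map `[a, 1%:i01] t = 1%:i01.
  by rewrite /char_map mem_set //= in_itv /= at_ I_le1.
move=> conv1; apply: (@I_neq01 R); rewrite -conv1.
apply/esym/I_le0/supI_le => _ [y [z [yz ->]]].
have -> : char_map `[a, a] z = 0%:i01.
  rewrite /char_map memNset //= in_itv /= => /andP[az za].
  by apply: no_y; exists y; rewrite (_ : a = z) //; apply/le_anti; rewrite az za.
(* 0 annihilates: star w 0 <= star 1 0 = 0 for every w *)
by rewrite sC -[leRHS]s1 [leRHS]sC [leLHS]sC; apply: sl; exact: I_le1.
Qed.

Section joint_continuity.
Variables (R : realType) (nabla : I R -> I R -> I R).
Hypothesis hn : is_tconorm nabla.
Hypothesis onto : forall a t : I R, a <= t -> exists y, nabla y a = t.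

Let monol z x y : x <= y -> nabla x z <= nabla y z.
Proof. by have [_ _ [+ _] _] := hn; exact. Qed.

Let monor z x y : x <= y -> nabla z x <= nabla z y.
Proof. by have [_ _ [_ +] _] := hn; exact. Qed.

Let nablaC : commutative nabla.
Proof. by have [] := hn. Qed.

Lemma corner_above x y t : nabla x y < t ->
  exists u v, [/\ x < u, y < v & nabla u v < t].
Proof.
move=> /I_dense[s2 cs2 s2t]; have [s1 cs1 s12] := I_dense cs2.
have [u us1] : exists u, nabla u y = s1.
  by apply/onto/ltW/(le_lt_trans _ cs1); have [] := tconorm_ge x y hn.
have [v vs2] : exists v, nabla v u = s2.
  apply/onto/ltW/(le_lt_trans _ s12); rewrite -us1.
  by have [] := tconorm_ge u y hn.
exists u, v; split; last by rewrite nablaC vs2.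
- by rewrite ltNge; apply/negP => /(monol y); rewrite us1 leNgt cs1.
- by rewrite ltNge; apply/negP => /(monor u); rewrite us1 nablaC vs2 leNgt s12.
Qed.

(** The rectangle is given by a disjunction because a factor above [t] already
    suffices, and the sections only reach the values above their parameter. *)
Lemma corner_below x y t : t < nabla x y ->
  [\/ t < x, t < y | exists u v, [/\ u < x, v < y & t < nabla u v]].
Proof.
move=> /I_dense[s1 ts1 s1c].
have [ty|yt] := ltP t y; first exact: Or32.
have [u us1] : exists u, nabla u y = s1 by apply/onto/(le_trans yt)/ltW.
have ux : u < x.
  by rewrite ltNge; apply/negP => /(monol y); rewrite us1 leNgt s1c.
have [tu|ut] := ltP t u; first by apply: Or31; exact: lt_trans ux.
have [s2 ts2 s21] := I_dense ts1.
have [v vs2] : exists v, nabla v u = s2 by apply/onto/(le_trans ut)/ltW.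
apply: Or33; exists u, v; split=> //; last by rewrite nablaC vs2.
by rewrite ltNge; apply/negP => /(monor u); rewrite us1 nablaC vs2 leNgt s21.
Qed.

Lemma continuous_fst_val :
  continuous (fun q : Itop R * Itop R => (q.1 : I R)%:num).
Proof.
move=> q; apply: (cvg_comp (fun q : Itop R * Itop R => q.1) _ cvg_fst).
exact: (@initial_continuous _ _ (fun x : I R => x%:num)).
Qed.

Lemma continuous_snd_val :
  continuous (fun q : Itop R * Itop R => (q.2 : I R)%:num).
Proof.
move=> q; apply: (cvg_comp (fun q : Itop R * Itop R => q.2) _ cvg_snd).
exact: (@initial_continuous _ _ (fun x : I R => x%:num)).
Qed.

Lemma near_nabla_lt (p : Itop R * Itop R) (t : I R) :
  nabla p.1 p.2 < t -> \forall q \near p, nabla q.1 q.2 < t.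
Proof.
move=> /corner_above[u [v [xu yv uvt]]].
near=> q; apply: le_lt_trans uvt.
apply: (@le_trans _ _ (nabla u q.2)); [apply/monol/ltW|apply/monor/ltW].
- near: q; exact: continuous_fst_val (lt_nbhsl xu).
- near: q; exact: continuous_snd_val (lt_nbhsl yv).
Unshelve. all: by end_near. Qed.

Lemma near_nabla_gt (p : Itop R * Itop R) (t : I R) :
  t < nabla p.1 p.2 -> \forall q \near p, t < nabla q.1 q.2.
Proof.
move=> /corner_below[tx|ty|[u [v [ux vy tuv]]]].
- near=> q; have [q1 _] := tconorm_ge q.1 q.2 hn; apply: lt_le_trans q1.
  near: q; exact: continuous_fst_val (lt_nbhsr tx).
- near=> q; have [_ q2] := tconorm_ge q.1 q.2 hn; apply: lt_le_trans q2.
  near: q; exact: continuous_snd_val (lt_nbhsr ty).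
- near=> q; apply: (lt_le_trans tuv).
  apply: (@le_trans _ _ (nabla u q.2)); [apply/monor/ltW|apply/monol/ltW].
  + near: q; exact: continuous_snd_val (lt_nbhsr vy).
  + near: q; exact: continuous_fst_val (lt_nbhsr ux).
Unshelve. all: by end_near. Qed.

Lemma continuous2_of_onto : continuous2 nabla.
Proof.
apply: continuous_comp_initial => p; apply/cvgrPdist_lt => e e0.
set c := nabla p.1 p.2.
(* if c + e leaves [0, 1], the upper bound holds everywhere; same for c - e *)
have up : \forall q \near p, (nabla q.1 q.2)%:num < c%:num + e.
  have [le1|gt1] := leP (c%:num + e) 1.
    have [||t ct te] := @I_between R c%:num (c%:num + e) c 1%:i01 (lexx _).
    - by rewrite ltrDl.
    - exact: le1.
    have := @near_nabla_lt p t ct; apply: filterS => q qt; exact: lt_trans te.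
  by apply: filterE => q; apply: le_lt_trans gt1.
have down : \forall q \near p, c%:num - e < (nabla q.1 q.2)%:num.
  have [ge0|lt0] := leP 0 (c%:num - e).
    have [|t te ct] := @I_between R (c%:num - e) c%:num 0%:i01 c ge0 _ (lexx _).
    - by rewrite ltrBlDr ltrDl.
    have := @near_nabla_gt p t ct; apply: filterS => q qt; exact: lt_trans te _.
  by apply: filterE => q; apply: lt_le_trans lt0 _.
apply: filterS2 up down => q /= qu qd.
by rewrite distrC ltr_distl qu qd.
Qed.

End joint_continuity.

Theorem theorem14 (R : realType) (star nabla : I R -> I R -> I R)
    (hnabla : is_tconorm nabla)
    (htr : is_tr_conorm (conv_map star nabla)) :
  (is_tconorm nabla /\ continuous2 nabla) /\ is_tnorm star.
Proof.
have hstar := star_tnorm hnabla htr.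
split=> //; split=> //.
exact: continuous2_of_onto (nabla_section_onto hstar htr).
Qed.
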